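(* Let $(W,S)$ be an arbitrary Coxeter system (possibly of infinite rank) with Coxeter graph $\Gamma$, and let $\tau\in\mathrm{Aut}\,\Gamma$. Then the fixed-point subgroup $W^\tau=\{w\in W\mid\tau(w)=w\}$ has finite index in $W$ if and only if $\tau$ is the identity on all irreducible components of $W$ except a finite number of finite irreducible components.
   Context: For a Coxeter system $(W,S)$ with $m_{s,t}$ the order of $st$, the Coxeter graph $\Gamma$ has vertex set $S$, with $s,t$ joined by an edge labelled $m_{s,t}$ iff $m_{s,t}\ge 3$ (possibly $\infty$). $\mathrm{Aut}\,\Gamma$ is the group of label-preserving graph automorphisms; each $\tau\in\mathrm{Aut}\,\Gamma$ extends uniquely to a group automorphism of $W$, also denoted $\tau$. An irreducible component of $W$ is a subgroup $W_I=\langle I\rangle$ with $I\subseteq S$ the vertex set of a connected component of $\Gamma$. $S$ is not assumed finite. *)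

(* Defs.v *)
From mathcomp Require Import all_boot.
From mathcomp Require Import boolp classical_sets functions cardinality.

Set Implicit Arguments.
Unset Strict Implicit.
Unset Printing Implicit Defensive.

Local Open Scope group_scope.
Local Open Scope classical_set_scope.

Section AbstractGroups.
Variable G : groupType.
Implicit Types (x : G) (A H : set G).

Definition is_subgroup H : Prop :=
  [/\ H 1, forall x y, H x -> H y -> H (x * y) & forall x, H x -> H x^-1].

Definition generated A : set G := smallest is_subgroup A.

Definition left_coset x H : set G := [set x * h | h in H].

Definition finite_index H : Prop :=
  finite_set [set left_coset x H | x in [set: G]].

(* [None] stands for infinite order. *)
Definition order_of x : option nat :=
  if pselect (exists n, (0 < n)%N && (x ^+ n == 1)) is left ex_n
  then Some (ex_minn ex_n) else None.

End AbstractGroups.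

Section CoxeterSystems.
Variables (W : groupType) (S : set W).
Implicit Types (s t : S) (tau : S -> S).

Definition coxeter_m s t : option nat := order_of (val s * val t).

(* The last field says that the generating set S and the relations
   (st)^m(s,t) = 1, for m(s,t) finite, form a presentation of W; it is stated
   as the universal property of the presented group (uniqueness of the
   extension g is automatic, since S generates W). *)
Record coxeter_system : Prop := CoxeterSystem {
  coxeter_gen : generated S = [set: W];
  coxeter_order2 : forall s, val s <> 1 /\ val s * val s = 1;
  coxeter_pres : forall (G : groupType) (f : S -> G),
    (forall s t k, coxeter_m s t = Some k -> (f s * f t) ^+ k = 1) ->
    exists2 g : W -> G, {morph g : x y / x * y} & forall s, g (val s) = f s
}.

Definition coxeter_edge : rel S :=
  fun s t => if coxeter_m s t is Some k then (3 <= k)%N else true.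

Definition coxeter_graph_aut tau : Prop :=
  [/\ bijective tau,
      forall s t, coxeter_edge (tau s) (tau t) = coxeter_edge s t &
      forall s t, coxeter_edge s t ->
        coxeter_m (tau s) (tau t) = coxeter_m s t].

Definition extends_aut tau (phi : W -> W) : Prop :=
  [/\ bijective phi, {morph phi : x y / x * y} &
      forall s, phi (val s) = val (tau s)].

(* The automorphism of W extending tau; see [ext_autP] and [ext_aut_unique].
   The default value [id] is never used when tau is a graph automorphism of a
   Coxeter system. *)
Definition ext_aut tau : W -> W := xget (id : W -> W) [set phi | extends_aut tau phi].

Definition fixed_subgroup tau : set W := [set w | ext_aut tau w = w].

Definition connected_component s : set S :=
  [set t | exists2 p : seq S, path coxeter_edge s p & last s p = t].

Definition parabolic (I : set S) : set W := generated [set val s | s in I].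

Definition irreducible_component (C : set W) : Prop :=
  exists s, C = parabolic (connected_component s).

Section Theory.
Hypothesis WS : coxeter_system.

Lemma coxeter_morph_eq (G : groupType) (f g : W -> G) :
  {morph f : x y / x * y} -> {morph g : x y / x * y} ->
  (forall s, f (val s) = g (val s)) -> f = g.
Proof.
move=> fM gM fg; apply/funext => w.
have morph1 (h : W -> G) : {morph h : x y / x * y} -> h 1 = 1.
  by move=> hM; apply: (@mulgI _ (h 1)); rewrite -hM !mulg1.
have morphV (h : W -> G) : {morph h : x y / x * y} -> forall x, h x^-1 = (h x)^-1.
  move=> hM x; apply: (@mulgI _ (h x)).
  by rewrite -hM !mulgV morph1.
suff : generated S `<=` [set w | f w = g w].
  by apply; rewrite (coxeter_gen WS).
apply: smallest_sub => [|x Sx]; last exact: (fg (SigSub (mem_set Sx))).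
split=> [|x y /= fx fy|x /= fx]; first by rewrite /= !morph1.
- by rewrite fM gM fx fy.
- by rewrite !morphV // fx.
Qed.

Lemma order_of_Some (x : W) k : order_of x = Some k -> (0 < k)%N /\ x ^+ k = 1.
Proof.
rewrite /order_of; case: pselect => // e [<-].
by case: ex_minnP => n /andP[n0 /eqP].
Qed.

Lemma order_of_min (x : W) n : (0 < n)%N -> x ^+ n = 1 ->
  exists2 k, order_of x = Some k & (k <= n)%N.
Proof.
move=> n0 xn; rewrite /order_of; case: pselect => [e|[]].
  by exists (ex_minn e) => //; case: ex_minnP => m _; apply; rewrite n0 xn eqxx.
by exists n; rewrite n0 xn eqxx.
Qed.

Lemma graph_aut_m tau s t :
  coxeter_graph_aut tau -> coxeter_m (tau s) (tau t) = coxeter_m s t.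
Proof.
case=> tau_bij tauE taum.
have m1 s' t' : (coxeter_m s' t' == Some 1%N) = (s' == t').
  have [_ ss] := coxeter_order2 WS s'.
  apply/eqP/eqP => [/order_of_Some[_ ]|<-].
    rewrite expg1 -[in RHS]ss => /mulgI h; exact/val_inj/esym.
  have [k e] := @order_of_min (val s' * val s') 1 isT ss.
  rewrite /coxeter_m e; have [k0 _] := order_of_Some e.
  by move=> k1; congr Some; apply/eqP; rewrite eqn_leq k1.
have [e|] := boolP (coxeter_edge s t); first exact: taum.
move=> ne; have := ne; rewrite -tauE.
have mk s' t' : ~~ coxeter_edge s' t' ->
    coxeter_m s' t' = if s' == t' then Some 1%N else Some 2%N.
  rewrite /coxeter_edge -m1; case E: coxeter_m => [[|[|[|k]]]|] //= _.
  by have [] := order_of_Some E.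
by move=> /mk ->; rewrite (mk _ _ ne) (inj_eq (bij_inj tau_bij)).
Qed.

Lemma graph_aut_extends tau :
  coxeter_graph_aut tau -> exists phi, extends_aut tau phi.
Proof.
move=> tauA; have mtau := graph_aut_m _ _ tauA.
have [[sig tauK sigK] _ _] := tauA.
have [s t k|phi phiM phiE] := coxeter_pres WS (f := fun s => val (tau s)).
  by rewrite -mtau => /order_of_Some[].
have [s t k|psi psiM psiE] := coxeter_pres WS (f := fun s => val (sig s)).
  by rewrite -[s]sigK -[t]sigK mtau !tauK => /order_of_Some[].
exists phi; split=> //; exists psi => w.
- have -> // : psi (phi w) = id w.
  apply: (congr1 (fun h => h w) (_ : psi \o phi = id)).
  apply: coxeter_morph_eq => // [x y|s] /=; first by rewrite phiM psiM.
  by rewrite phiE psiE tauK.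
- apply: (congr1 (fun h => h w) (_ : phi \o psi = id)).
  apply: coxeter_morph_eq => // [x y|s] /=; first by rewrite psiM phiM.
  by rewrite psiE phiE sigK.
Qed.

Lemma ext_autP tau : coxeter_graph_aut tau -> extends_aut tau (ext_aut tau).
Proof. by move=> /graph_aut_extends; apply: xgetPex. Qed.

Lemma ext_aut_unique tau phi : coxeter_graph_aut tau ->
  extends_aut tau phi -> phi = ext_aut tau.
Proof.
move=> /ext_autP[_ eM eE] [_ pM pE].
by apply: coxeter_morph_eq => // s; rewrite eE pE.
Qed.

End Theory.
End CoxeterSystems.

(* Main.v *)
Require Import Defs.
From HB Require Import structures.
From mathcomp Require Import all_boot all_order all_algebra.
From mathcomp Require Import ring lra zify.
From mathcomp Require Import boolp classical_sets functions cardinality.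
From mathcomp Require Import Rstruct reals trigo.

(** Let [H] be the fixed subgroup, of finite index, and let [s] be a simple
    reflection with [r = tau s <> s]. If [n] and [s n s] are both fixed by
    [tau], then [n] commutes with [rs], hence preserves the plane spanned by
    the simple roots of [s] and [r] in the geometric representation; as it also
    commutes with [tau] and preserves the form, it maps the root of [s] to the
    root of [s] or [r], up to sign. Such [n] form a subgroup of finite index, so
    the orbit of the root of [s] is finite. If [s] and [t] are joined in the
    graph, the root of [t] is a linear combination of two roots in the orbit of
    [s]: finiteness of orbits propagates along edges. The supports of the roots
    in the orbit of [s] fill the connected component of [s], which is therefore
    finite, and since the geometric representation is faithful (Tits), so is
    the parabolic subgroup it generates. Finally [s] and [t] moved by [tau]
    lie in the same left coset of [H] only if [t] is [s] or [tau s], so that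
    only finitely many simple reflections are moved.

    Conversely, [W] is the product of the finite group generated by the
    exceptional components and of a subgroup of [H]. *)

Import Order.TTheory GRing.Theory Num.Theory.

Set Implicit Arguments.
Unset Strict Implicit.
Unset Printing Implicit Defensive.

(** * Chebyshev coefficients of rank two root systems *)

Section ChebyshevSequence.
Variable R : realType.
Local Open Scope ring_scope.

(* [cheb (2 cos x) k = sin (k x) / sin x]: the coefficients of the roots of a
   rank two root system. *)
Fixpoint cheb (c : R) (k : nat) : R :=
  if k is k1.+1 then
    if k1 is k2.+1 then c * cheb c k1 - cheb c k2 else 1
  else 0.

Lemma chebSS c k : cheb c k.+2 = c * cheb c k.+1 - cheb c k.
Proof. by []. Qed.

Lemma cheb_ind2 (P : nat -> Prop) :
  P 0%N -> P 1%N -> (forall k, P k -> P k.+1 -> P k.+2) -> forall k, P k.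
Proof.
move=> P0 P1 PS k; have [] // : P k /\ P k.+1.
by elim: k => [|k [Pk Pk1]]; split=> //; apply: PS.
Qed.

Lemma cheb_sin x k : cheb (2 * cos x) k * sin x = sin (k%:R * x).
Proof.
elim/cheb_ind2: k => [||k IH0 IH1].
- by rewrite /= !mul0r sin0.
- by rewrite /= !mul1r.
rewrite chebSS mulrBl -[_ * sin x]mulrA IH0 IH1.
have -> : k.+2%:R * x = k.+1%:R * x + x by ring.
have -> : k%:R * x = k.+1%:R * x - x by ring.
by rewrite sinB sinD; ring.
Qed.

(** Serves the infinite label; monotonicity is carried along because the recursion subtracts the
    earlier term. *)
Lemma cheb3_ge0 k : 0 <= cheb 3 k <= cheb 3 k.+1.
Proof.
elim: k => [|k /andP[k0 k1]]; first by rewrite /= lexx ler01.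
by rewrite chebSS; apply/andP; split; lra.
Qed.

(* For an infinite label any value [> 2] gives a faithful representation; unlike
   the customary [2] it makes the form nondegenerate on every pair of
   distinct simple roots. *)
Definition cox_coef (m : option nat) : R :=
  if m is Some k then 2 * cos (pi / k%:R) else 3.

Lemma cox_coef1 : cox_coef (Some 1%N) = -2.
Proof. by rewrite /cox_coef divr1 cospi; ring. Qed.

Lemma cox_angle m : (2 <= m)%N -> 0 < (pi : R) / m%:R <= pi / 2.
Proof.
move=> m2; have m0 : 0 < m%:R :> R by rewrite ltr0n; lia.
rewrite divr_gt0 ?pi_gt0 //= ler_wpM2l ?pi_ge0 // lef_pV2 ?posrE //.
by rewrite ler_nat.
Qed.

Lemma cox_sin_gt0 m : (2 <= m)%N -> 0 < sin ((pi : R) / m%:R).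
Proof.
move=> /cox_angle/andP[a0 a1]; rewrite sin_gt0_pi // a0 (le_lt_trans a1) //.
by rewrite ltr_pdivrMr // ltr_pMr ?pi_gt0 // ltr1n.
Qed.

Lemma cox_coef_ge0 m : (if m is Some k then 2 <= k else true)%N ->
  0 <= cox_coef m.
Proof.
case: m => //= k /cox_angle/andP[a0 a1].
by rewrite mulr_ge0 // cos_ge0_pihalf // a1 andbT; lra.
Qed.

Lemma cox_coef_gt0 m : (if m is Some k then 3 <= k else true)%N ->
  0 < cox_coef m.
Proof.
case: m => //= k k3; have k0 : 0 < k%:R :> R by rewrite ltr0n; lia.
rewrite mulr_gt0 // cos_gt0_pihalf //; apply/andP; split.
  by apply: (@lt_trans _ _ 0); rewrite ?oppr_lt0 ?divr_gt0 ?pi_gt0.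
by rewrite ltr_pM2l ?pi_gt0 // ltf_pV2 ?posrE // ltr_nat.
Qed.

(** [4 - c ^+ 2] is the Gram determinant of the form on two distinct simple roots:
    [4 * sin (pi / k) ^+ 2] for a finite label [k], and [-5] for the infinite one. *)
Lemma cox_coef_neq m : (if m is Some k then 2 <= k else true)%N ->
  4 - cox_coef m ^+ 2 != 0.
Proof.
case: m => [k|_] /=; last by apply/eqP; lra.
move=> /cox_sin_gt0 s0.
have -> : 4 - (2 * cos (pi / k%:R)) ^+ 2 = 4 * sin (pi / k%:R) ^+ 2 :> R.
  by rewrite sin2cos2; ring.
by rewrite mulf_neq0 // ?pnatr_eq0 // expf_neq0 // gt_eqF.
Qed.

(** For a finite label [n], the value times [sin (pi / n)] is the sine of [k * pi / n], and [k <= n]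
    keeps this angle between [0] and [pi]. *)
Lemma cox_cheb_ge0 m k : (if m is Some n then 2 <= n else true)%N ->
  (if m is Some n then k <= n else true)%N -> 0 <= cheb (cox_coef m) k.
Proof.
case: m => [n|_ _] /=; last by case/andP: (cheb3_ge0 k).
move=> n2 kn; have /andP[a0 a1] := cox_angle n2.
have n0 : 0 < n%:R :> R by rewrite ltr0n; lia.
have s0 := cox_sin_gt0 n2.
rewrite -(pmulr_lge0 _ s0) cheb_sin sin_ge0_pi //; apply/andP; split.
  by rewrite mulr_ge0 // ltW.
by rewrite mulrCA ger_pMr ?pi_gt0 // ler_pdivrMr // mul1r ler_nat.
Qed.

(** [2 * n] steps of angle [pi / n] make a full turn; this is the source of the relations
    [(s t)^m = 1] in the representation. *)
Lemma cox_cheb_period n : (2 <= n)%N ->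
  cheb (cox_coef (Some n)) (2 * n) = 0 /\ cheb (cox_coef (Some n)) (2 * n).+1 = 1.
Proof.
move=> n2; have n0 : n%:R != 0 :> R by rewrite pnatr_eq0; lia.
have s0 : sin (pi / n%:R) != 0 :> R.
  by rewrite gt_eqF // cox_sin_gt0.
have e : (2 * n)%:R * (pi / n%:R) = pi *+ 2 :> R.
  by rewrite natrM; field.
split; apply: (mulIf s0); rewrite cheb_sin ?mul0r ?mul1r.
  by rewrite e sin2pi.
by rewrite -addn1 natrD mulrDl e mul1r addrC sinD2pi.
Qed.

End ChebyshevSequence.

(** * The group of self-bijections of a type *)

Section BijectionGroup.
Variable T : Type.

(** The inverse is kept as data so that inversion in the group merely swaps fields; the group is to
    be a target for the universal property of the presentation. *)
Record selfbij := SelfBij {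
  bfun : T -> T;
  binv : T -> T;
  bfunK : cancel bfun binv;
  binvK : cancel binv bfun
}.

Lemma bijP (f g : selfbij) : bfun f = bfun g -> f = g.
Proof.
case: f g => [f f' fK f'K] [g g' gK g'K] /= e; subst g.
have e : f' = g' by apply/funext => x; rewrite -{1}[x]g'K fK.
by subst g'; congr SelfBij; apply: Prop_irrelevance.
Qed.

HB.instance Definition _ := gen_eqMixin selfbij.
HB.instance Definition _ := gen_choiceMixin selfbij.

Definition bij1 : selfbij := @SelfBij id id (fun _ => erefl) (fun _ => erefl).
Definition bijV f : selfbij := SelfBij (@binvK f) (@bfunK f).
Definition bijM f g : selfbij :=
  SelfBij (can_comp (@bfunK f) (@bfunK g)) (can_comp (@binvK g) (@binvK f)).

Fact bijMA : associative bijM. Proof. by move=> f g h; apply: bijP. Qed.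
Fact bij1M : left_id bij1 bijM. Proof. by move=> f; apply: bijP. Qed.
Fact bijM1 : right_id bij1 bijM. Proof. by move=> f; apply: bijP. Qed.
Fact bijVM : left_inverse bij1 bijV bijM.
Proof. by move=> f; apply/bijP/funext => x /=; apply: bfunK. Qed.
Fact bijMV : right_inverse bij1 bijV bijM.
Proof. by move=> f; apply/bijP/funext => x /=; apply: binvK. Qed.

HB.instance Definition _ := isGroup.Build selfbij bijMA bij1M bijM1 bijVM bijMV.

End BijectionGroup.

(** * Words and length in a Coxeter group *)

Section Words.
Local Open Scope classical_set_scope.
Local Open Scope group_scope.
Variables (W : groupType) (S : set W).
Hypothesis WS : coxeter_system S.
Implicit Types (s t u : S) (w v : W) (p q : seq S).

Lemma genK s : val s * val s = 1.
Proof. by case: (coxeter_order2 WS s). Qed.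

Lemma genV s : (val s)^-1 = val s.
Proof. by apply: (@mulgI _ (val s)); rewrite mulgV genK. Qed.

Lemma genKV s w : val s * (val s * w) = w.
Proof. by rewrite mulgA genK mul1g. Qed.

Lemma order_of_eq (x y : W) :
  (forall n, (x ^+ n == 1) = (y ^+ n == 1)) -> order_of x = order_of y.
Proof.
move=> xy; rewrite /order_of; case: pselect => [ex|nx]; case: pselect => [ey|ny] //.
- by congr Some; apply: eq_ex_minn => n; rewrite xy.
- by case: ny; case: ex => n; exists n; rewrite -xy.
- by case: nx; case: ey => n; exists n; rewrite xy.
Qed.

Lemma coxeter_mC s t : coxeter_m s t = coxeter_m t s.
Proof.
apply: order_of_eq => n.
have -> : val t * val s = (val s * val t)^-1 by rewrite invgM !genV.
by rewrite expVgn invg_eq1.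
Qed.

Lemma coxeter_mss s : coxeter_m s s = Some 1%N.
Proof.
have [//|k e] := @order_of_min W (val s * val s) 1%N isT.
  by rewrite expg1 genK.
have [k0 _] := order_of_Some e.
by rewrite /coxeter_m e => k1; congr Some; lia.
Qed.

Lemma coxeter_m_neq s t : s != t ->
  (if coxeter_m s t is Some k then 2 <= k else true)%N.
Proof.
move=> st; case e: coxeter_m => [[|[|k]]|] //.
  by have [] := order_of_Some e.
have [_] := order_of_Some e; rewrite expg1 => h; case/eqP: st; apply: val_inj.
by rewrite /= -[LHS]mulg1 -(genK t) mulgA h mul1g.
Qed.

Lemma coxeter_edge_sym s t : coxeter_edge s t = coxeter_edge t s.
Proof. by rewrite /coxeter_edge coxeter_mC. Qed.

Lemma coxeter_edge_neq s t : coxeter_edge s t -> s != t.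
Proof. by apply: contraTneq => ->; rewrite /coxeter_edge coxeter_mss. Qed.

Lemma coxeter_non_edge s t :
  s != t -> ~~ coxeter_edge s t -> coxeter_m s t = Some 2%N.
Proof.
move=> /coxeter_m_neq; rewrite /coxeter_edge.
by case: coxeter_m => [[|[|[|k]]]|].
Qed.

Lemma connected_component_edge s t u : connected_component s t ->
  coxeter_edge t u -> connected_component s u.
Proof.
by case=> p sp <- tu; exists (rcons p u); rewrite ?last_rcons // rcons_path sp.
Qed.

Lemma coxeter_comm s t : ~~ coxeter_edge s t -> val s * val t = val t * val s.
Proof.
have [->//|st] := eqVneq s t; move=> /(coxeter_non_edge st)/order_of_Some[_].
rewrite expgS expg1 => h; apply: (@mulIg _ (val s * val t)).
by rewrite h -!mulgA genKV genK.
Qed.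

Definition word p : W := foldr (fun s w => val s * w) 1 p.

Lemma word_cat p q : word (p ++ q) = word p * word q.
Proof. by elim: p => [|s p IH] /=; rewrite ?mul1g // IH mulgA. Qed.

Lemma word_rev p : word (rev p) = (word p)^-1.
Proof.
elim: p => [|s p IH] /=; first by rewrite invg1.
by rewrite rev_cons -cats1 word_cat IH invgM genV /= mulg1.
Qed.

Lemma parabolic_subgroup (I : set S) : is_subgroup (parabolic I).
Proof.
split=> [|x y Hx Hy|x Hx] H HH; have [[H1 HM HV] _] := HH; first exact: H1.
- by apply: HM; [apply: (Hx H)|apply: (Hy H)].
- by apply: HV; apply: (Hx H).
Qed.

Lemma parabolicP (I : set S) w : parabolic I w ->
  exists2 p, (forall s, s \in p -> I s) & w = word p.
Proof.
move: w; apply: smallest_sub => [|_ [s Is <-]]; last first.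
  by exists [:: s]; rewrite /= ?mulg1 // => t; rewrite inE => /eqP ->.
split=> [|_ _ [p Ip ->] [q Iq ->]|_ [p Ip ->]]; first by exists [::].
- exists (p ++ q); rewrite ?word_cat // => s.
  by rewrite mem_cat => /orP[/Ip|/Iq].
- by exists (rev p); rewrite ?word_rev // => s; rewrite mem_rev => /Ip.
Qed.

Lemma wordP w : exists p, word p = w.
Proof.
have [|p _ ->] := @parabolicP [set: S] w; last by exists p.
rewrite /parabolic (_ : [set val s | s in [set: S]] = S) ?(coxeter_gen WS) //.
apply/seteqP; split=> [_ [s _ <-]|x Sx]; first exact/set_mem/valP.
by exists (SigSub (mem_set Sx)).
Qed.

Lemma gen_ind (P : W -> Prop) :
  P 1 -> (forall s w, P w -> P (val s * w)) -> forall w, P w.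
Proof.
by move=> P1 PS w; have [p <-] := wordP w; elim: p => //= s p; apply: PS.
Qed.

Lemma gen_indr (P : W -> Prop) :
  P 1 -> (forall w s, P w -> P (w * val s)) -> forall w, P w.
Proof.
move=> P1 PS w; have [p <-] := wordP w; elim/last_ind: p => //= p s.
by rewrite -cats1 word_cat /= mulg1; apply: PS.
Qed.

Let has_len w : exists n, `[< exists2 p, size p = n & word p = w >].
Proof. by have [p pw] := wordP w; exists (size p); apply/asboolP; exists p. Qed.

Definition len w : nat := ex_minn (has_len w).

Lemma len_word p : (len (word p) <= size p)%N.
Proof.
by rewrite /len; case: ex_minnP => n _; apply; apply/asboolP; exists p.
Qed.

Lemma lenP w : exists2 p, size p = len w & word p = w.
Proof. by rewrite /len; case: ex_minnP => n /asboolP. Qed.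

Lemma len_cat p w : (len (word p * w) <= size p + len w)%N.
Proof.
by have [q <- <-] := lenP w; rewrite -word_cat -size_cat len_word.
Qed.

Lemma len_gen s w : (len (val s * w) <= (len w).+1)%N.
Proof. by have := len_cat [:: s] w; rewrite /= mulg1. Qed.

Lemma len_descent w : w <> 1 -> exists s, len w = (len (val s * w)).+1.
Proof.
have [[|s p] sp pw] := lenP w; first by case; rewrite -pw.
move=> _; exists s; rewrite -sp -pw /= genKV.
have := len_gen s (word p); have := len_word p.
by rewrite -[val s * _]/(word (s :: p)) pw -sp /=; lia.
Qed.

End Words.

(** * The geometric representation and its form *)

Section Representation.
Local Open Scope ring_scope.
Variables (R : realType) (W : groupType) (S : set W).
Hypothesis WS : coxeter_system S.
Implicit Types (s t u : S) (w v : W) (f h : S -> R).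

Definition cox_form s t : R := - cox_coef R (coxeter_m s t).

Lemma cox_formC s t : cox_form s t = cox_form t s.
Proof. by rewrite /cox_form coxeter_mC. Qed.

Lemma cox_formss s : cox_form s s = 2.
Proof. by rewrite /cox_form coxeter_mss // cox_coef1 opprK. Qed.

Lemma cox_form_le0 s t : s != t -> cox_form s t <= 0.
Proof. by move=> st; rewrite oppr_le0 cox_coef_ge0 // coxeter_m_neq. Qed.

Lemma cox_form_lt0 s t : coxeter_edge s t -> cox_form s t < 0.
Proof. by move=> st; rewrite oppr_lt0 cox_coef_gt0. Qed.

Lemma cox_form_eq0 s t : s != t -> ~~ coxeter_edge s t -> cox_form s t = 0.
Proof.
by move=> st nst; rewrite /cox_form coxeter_non_edge //= cos_pihalf mulr0 oppr0.
Qed.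

Lemma cox_form_neq s t : s != t -> 4 - cox_form s t ^+ 2 != 0.
Proof. by move=> st; rewrite sqrrN cox_coef_neq // coxeter_m_neq. Qed.

(* The contragredient of the geometric representation; a vector is
   identified with its values on the simple roots, so that [act w f s] below
   is the value at [f] of the root [w^-1 s]. *)
Definition refl s f : S -> R := fun u => f u - f s * cox_form s u.

Lemma reflK s : involutive (refl s).
Proof. by move=> f; apply/funext => u; rewrite /refl cox_formss; ring. Qed.

(** [p] and [q] are chosen so that [f] agrees with [p * cox_form s + q * cox_form t] at [s] and [t].
    The difference vanishes at both, hence is fixed by both reflections; only the planar part
    evolves, with Chebyshev coefficients. *)
Lemma iter_refl s t f k : s != t ->
  let c := - cox_form s t in
  let p := (2 * f s + c * f t) / (4 - c ^+ 2) in
  let q := (c * f s + 2 * f t) / (4 - c ^+ 2) in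
  let x := cheb c (2 * k) in
  let y := cheb c (2 * k).+1 in
  iter k (refl s \o refl t) f =
  fun u => f u + (y * p - x * q - p) * cox_form s u
               + (x * p - (c * x - y) * q - q) * cox_form t u.
Proof.
move=> st c p q x y; rewrite {}/x {}/y.
have c0 : 4 - c ^+ 2 != 0 by rewrite sqrrN cox_form_neq.
have fs : f s = 2 * p - c * q by rewrite /p /q; field.
have ft : f t = 2 * q - c * p by rewrite /p /q; field.
have cE : cox_form s t = - c by rewrite opprK.
elim: k => [|k IH]; apply/funext => u.
  by rewrite muln0 /=; ring.
rewrite iterS IH mulnS add2n !chebSS.
move: (cheb c (2 * k)) (cheb c (2 * k).+1) => x y; rewrite /= /refl.
by rewrite !cox_formss (cox_formC t s) cE fs ft; ring.
Qed.

Lemma braid_refl s t k : coxeter_m s t = Some k ->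
  iter k (refl s \o refl t) =1 id.
Proof.
have [->|st] := eqVneq s t.
  by rewrite coxeter_mss // => -[<-] f /=; rewrite reflK.
move=> e f; rewrite iter_refl // /cox_form e opprK.
have k2 : (2 <= k)%N by have := coxeter_m_neq WS st; rewrite e.
have [-> ->] := cox_cheb_period R k2.
by apply/funext => u; ring.
Qed.

Lemma geometric_action : exists act : W -> (S -> R) -> (S -> R),
  [/\ forall f, act 1%g f = f,
      forall w v f, act (w * v)%g f = act w (act v f) &
      forall s f, act (val s) f = refl s f].
Proof.
pose sg s : selfbij (S -> R) := SelfBij (reflK s) (reflK s).
have [s t k /braid_refl st|g gM gE] := coxeter_pres WS (f := sg).
  apply/bijP/funext => f; rewrite -[RHS](st f).
  elim: (k) => [//|n IH]; by rewrite expgS /= IH.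
exists (fun w => bfun (g w)); split=> [f|w v f|s f].
- have -> : g 1%g = 1%g by apply: (@mulgI _ (g 1%g)); rewrite -gM !mulg1.
  by [].
- by rewrite gM.
- by rewrite gE.
Qed.

End Representation.

(** * Alternating words in two letters *)

Section AlternatingWords.
Variable T : Type.

Fixpoint alt (x y : T) k : seq T := if k is k'.+1 then x :: alt y x k' else [::].

Lemma size_alt x y k : size (alt x y k) = k.
Proof. by elim: k x y => //= k IH x y; rewrite IH. Qed.

Lemma altSr x y k : alt x y k.+1 = rcons (alt x y k) (if odd k then y else x).
Proof.
elim: k x y => // k IH x y.
by rewrite [LHS]/= -[y :: alt x y k]/(alt y x k.+1) IH /=; case: (odd k).
Qed.

Lemma alt_cat x y k m : m <= k ->
  exists2 r, size r = k - m & alt x y k = alt x y m ++ r.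
Proof.
elim: m k x y => [|m IH] [|k] x y //= mk.
- by exists [::].
- by exists (alt x y k.+1); rewrite ?size_alt.
- by have [r sr ->] := IH k y x mk; exists r.
Qed.

End AlternatingWords.

(** * Positivity of roots and faithfulness *)

Section Positivity.
Variables (R : realType) (W : groupType) (S : set W).
Hypothesis WS : coxeter_system S.
Variable act : W -> (S -> R) -> (S -> R).
Hypothesis act1 : forall f, act 1%g f = f.
Hypothesis actM : forall w v f, act (w * v)%g f = act w (act v f).
Hypothesis actg : forall s f, act (val s) f = refl s f.
Implicit Types (s t u : S) (w v : W) (f h : S -> R).
Local Notation cox_form := (@cox_form R W S).

(** When [k] is the order of [s t] the power disappears and this is the braid relation. *)
Lemma word_alt s t k :
  (word (alt s t k) = (val s * val t) ^+ k * word (alt t s k))%g.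
Proof.
elim: k s t => [|k IH] s t; first by rewrite /= mul1g.
rewrite -[LHS]/(val s * word (alt t s k))%g IH /= expgSr.
have e : (val s * (val t * val s) ^+ k = (val s * val t) ^+ k * val s)%g.
  elim: (k) => [|n IHn]; first by rewrite mulg1 mul1g.
  by rewrite !expgS mulgA -mulgA -mulgA IHn !mulgA.
by rewrite mulgA e -!mulgA (genKV WS).
Qed.

Local Open Scope ring_scope.

Lemma act_alt s t k h : let c := - cox_form s t in
  act (word (alt t s k)) h s =
  if odd k then cheb c k * h s + cheb c k.+1 * h t
  else cheb c k.+1 * h s + cheb c k * h t.
Proof.
move=> c; have cE : cox_form s t = - c by rewrite opprK.
elim: k h => [|k IH] h; first by rewrite /= act1 mul1r mul0r addr0.
rewrite altSr -cats1 word_cat actM IH chebSS.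
move: (cheb c k) (cheb c k.+1) => x y; rewrite /= mulg1 actg; case: (odd k).
  by rewrite /refl cox_formss // cE; ring.
by rewrite /refl cox_formss // (cox_formC R WS) cE; ring.
Qed.

(* Tits: [w] is factored as [word (alt t s k) * v] with lengths adding up and
   [v] of minimal length, so that the claim holds for [v] and both [s], [t]. *)
Theorem act_ge0 w s f : (len WS w <= len WS (val s * w)%g)%N ->
  (forall u, 0 <= f u) -> 0 <= act w f s.
Proof.
have [n] := ubnP (len WS w); elim: n w s => // n IH w s wn sw f0.
have [->|/(len_descent WS)[t wt]] := pselect (w = 1%g); first by rewrite act1.
have st : s != t by apply/eqP => e; move: sw wt; rewrite e; lia.
pose Q v k := w = (word (alt t s k) * v)%g /\ len WS w = (k + len WS v)%N.
have Q1 : Q (val t * w)%g 1%N by split=> //=; rewrite mulg1 (genKV WS).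
have exQ : exists j, `[< exists v k, Q v k /\ len WS v = j >].
  by exists (len WS (val t * w)%g); apply/asboolP; exists (val t * w)%g, 1%N.
case: (ex_minnP exQ) => _ /asboolP[v [k [Qvk <-]]] minv.
have {}minv v' k' : Q v' k' -> (len WS v <= len WS v')%N.
  by move=> Qv'; apply: minv; apply/asboolP; exists v', k'.
have [wE wl] := Qvk.
have k0 : (0 < k)%N by have := minv _ _ Q1; lia.
(* [z] is the last letter of [alt t s k] and [y] the letter that would come next. A shorter [y v]
   would contradict the minimality of [v], a shorter [z v] the length of [w]; together [y] and [z]
   are [s] and [t]. *)
pose y := if odd k then s else t; pose z := if odd k.-1 then s else t.
have vy : (len WS v <= len WS (val y * v)%g)%N.
  rewrite leqNgt; apply/negP => h.
  have e : w = (word (alt t s k.+1) * (val y * v))%g.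
    by rewrite altSr -cats1 word_cat /= mulg1 -mulgA (genKV WS).
  have := len_cat WS (alt t s k.+1) (val y * v)%g; rewrite -e size_alt => h'.
  suff : (len WS v <= len WS (val y * v)%g)%N by lia.
  by apply: (minv _ k.+1); split=> //; lia.
have vz : (len WS v <= len WS (val z * v)%g)%N.
  have e : w = (word (alt t s k.-1) * (val z * v))%g.
    rewrite wE -{1}(prednK k0) altSr -cats1 word_cat /= mulg1 -/z.
    by rewrite -!mulgA.
  by have := len_cat WS (alt t s k.-1) (val z * v)%g; rewrite -e size_alt; lia.
have vs_vt : (len WS v <= len WS (val s * v)%g)%N
          /\ (len WS v <= len WS (val t * v)%g)%N.
  move: vy vz; rewrite /y /z -(prednK k0) /=.
  by case: (odd k.-1) => /= ? ?; split.
have vn : (len WS v < n)%N by lia.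
have vs := IH v s vn vs_vt.1 f0; have vt := IH v t vn vs_vt.2 f0.
(* Otherwise the braid relation turns the first [m] letters into a word starting with [s], and [s w]
   would be shorter than [w]. *)
have km : if coxeter_m s t is Some m then (k < m)%N else true.
  case e : (coxeter_m s t) => [m|//]; rewrite ltnNge; apply/negP => mk.
  have [m0 stm] := order_of_Some e.
  have [r sr kr] := alt_cat t s mk.
  have := len_cat WS (alt t s m.-1 ++ r) v.
  rewrite (_ : word _ * v = val s * w)%g ?size_cat ?size_alt; first by lia.
  have tsm : word (alt t s m) = (val s * word (alt t s m.-1))%g.
    by rewrite -[RHS]/(word (alt s t m.-1.+1)) (prednK m0) (word_alt s t) stm mul1g.
  by rewrite wE kr !word_cat tsm -!mulgA (genKV WS).
rewrite wE actM act_alt.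
have m2 := coxeter_m_neq WS st.
have c0 : 0 <= cheb (- cox_form s t) k.
  by rewrite opprK cox_cheb_ge0 //; case: (coxeter_m s t) km => // m /ltnW.
have c1 : 0 <= cheb (- cox_form s t) k.+1.
  by rewrite opprK; apply: cox_cheb_ge0 m2 _; case: (coxeter_m s t) km.
by case: ifP => _; rewrite addr_ge0 // mulr_ge0.
Qed.

Lemma act_le0 w s f : (len WS (val s * w)%g < len WS w)%N ->
  (forall u, 0 <= f u) -> act w f s <= 0.
Proof.
move=> sw f0; have := @act_ge0 (val s * w)%g s f.
rewrite (genKV WS) actM actg /refl cox_formss // => /(_ (ltnW sw) f0); lra.
Qed.

(** The constant function [1] is positive on every simple root, but a nontrivial [w] has a descent
    [s], where its image would be nonpositive. *)
Lemma act_faithful w : (forall f, act w f = f) -> w = 1%g.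
Proof.
move=> wf; apply: contrapT => /(len_descent WS)[s ws].
have := @act_le0 w s (fun=> 1); rewrite wf ws ltnSn.
by move=> /(_ isT (fun=> ler01)); rewrite ler10.
Qed.

End Positivity.

(** * Finiteness through fibres *)

Section FiniteSets.
Local Open Scope classical_set_scope.

Lemma finite_image_fibers (T U V : Type) (A : set T) (F : T -> U) (g : T -> V) :
  finite_set (g @` A) ->
  (forall x, A x -> finite_set (F @` [set y | A y /\ g y = g x])) ->
  finite_set (F @` A).
Proof.
move=> fg fF; apply: (@sub_finite_set _ _
  (\bigcup_(v in g @` A) F @` [set y | A y /\ g y = v])) => [_ [x Ax <-]|].
  by exists (g x); exists x.
by apply: bigcup_finite => // _ [x Ax <-]; apply: fF.
Qed.

Lemma finite_fibers (T V : Type) (A : set T) (g : T -> V) :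
  finite_set (g @` A) ->
  (forall x, A x -> finite_set [set y | A y /\ g y = g x]) -> finite_set A.
Proof.
move=> fg fA; rewrite -[A]image_id.
by apply: finite_image_fibers fg _ => x /fA; rewrite image_id.
Qed.

Lemma finite_range_map (T U : Type) (I : eqType) (F : T -> I -> U) (l : seq I) :
  (forall i, i \in l -> finite_set (range (F^~ i))) ->
  finite_set (range (fun x => [seq F x i | i <- l])).
Proof.
elim: l => [_|i l IH Fl].
  by apply: (sub_finite_set _ (finite_set1 [::])) => _ [x _ <-].
apply: (@sub_finite_set _ _ ((fun p => p.1 :: p.2) @`
  (range (F^~ i) `*` range (fun x => [seq F x i | i <- l])))) => [_ [x _ <-]|].
  by exists (F x i, [seq F x i | i <- l]) => //; split; exists x.
apply: finite_image; apply: finite_setX; first by apply: Fl; rewrite mem_head.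
by apply: IH => j jl; apply: Fl; rewrite inE jl orbT.
Qed.

End FiniteSets.

(** * Finite root orbits and finite components *)

Section Orbits.
Local Open Scope classical_set_scope.
Local Open Scope ring_scope.
Variables (R : realType) (W : groupType) (S : set W).
Hypothesis WS : coxeter_system S.
Variable act : W -> (S -> R) -> (S -> R).
Hypothesis act1 : forall f, act 1%g f = f.
Hypothesis actM : forall w v f, act (w * v)%g f = act w (act v f).
Hypothesis actg : forall s f, act (val s) f = refl s f.
Implicit Types (s t u v : S) (w : W) (f h : S -> R).
Local Notation cox_form := (@cox_form R W S).

Lemma act_lin w a b f h :
  act w (fun u => a * f u + b * h u) = fun u => a * act w f u + b * act w h u.
Proof.
elim/(gen_ind WS): w => [|s w IH]; first by rewrite !act1.
by rewrite !actM !actg IH; apply/funext => u; rewrite /refl; ring.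
Qed.

(** The orbit of the simple root [s], each root [w^-1 s] being encoded as an evaluation functional
    on [S -> R]. *)
Definition root_orbit s : set ((S -> R) -> R) := range (fun w f => act w f s).

(** Reflecting the root [s] in [t] subtracts [cox_form t s] times the root [t], and this coefficient
    is nonzero along an edge. *)
Lemma finite_orbit_edge s t : coxeter_edge s t ->
  finite_set (root_orbit s) -> finite_set (root_orbit t).
Proof.
move=> st fs.
apply: (@sub_finite_set _ _ ((fun p f => (p.1 f - p.2 f) / cox_form t s) @`
  (root_orbit s `*` root_orbit s))); last exact/finite_image/finite_setX.
move=> _ [w _ <-].
exists ((fun f => act w f s), (fun f => act (val t * w)%g f s)).
  by split; [exists w|exists (val t * w)%g].
apply/funext => f; rewrite /= actM actg /refl opprB addrC subrK mulfK //.
by rewrite lt_eqF // cox_form_lt0 // coxeter_edge_sym.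
Qed.

Lemma finite_orbit_component s t : connected_component s t ->
  finite_set (root_orbit s) -> finite_set (root_orbit t).
Proof.
case=> p; elim: p s => [|u p IH] s /=; first by move=> _ ->.
by move=> /andP[su up] ut /(finite_orbit_edge su); apply: IH.
Qed.

Definition delta u : S -> R := fun v => (v == u)%:R.

(** [act w (delta u) s] is the coefficient of the simple root [u] in the root [w^-1 s]. *)
Definition root_support s : set S := [set u | exists w, act w (delta u) s != 0].

(** Each single root has finite support, since passing from [w] to [w t] can add only [t]. *)
Lemma finite_root_support s :
  finite_set (root_orbit s) -> finite_set (root_support s).
Proof.
move=> fs; apply: (@sub_finite_set _ _
  (\bigcup_(phi in root_orbit s) [set u | phi (delta u) != 0])) => [u [w wu]|].
  by exists (fun f => act w f s) => //; exists w.
apply: bigcup_finite => // _ [w _ <-].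
elim/(gen_indr WS): w => [|w t IH].
  apply: (sub_finite_set _ (finite_set1 s)) => u /=.
  by rewrite act1 /delta; case: (eqVneq s u) => [->|_] //; rewrite eqxx.
have : finite_set ([set t] `|` [set u | act w (delta u) s != 0]).
  by rewrite finite_setU; split.
apply: sub_finite_set => u /= wu; have [->|tu] := eqVneq u t; first by left.
right; move: wu; rewrite actM actg.
rewrite (_ : refl t (delta u) = delta u) //.
by apply/funext => v; rewrite /refl {2}/delta eq_sym (negPf tu) mul0r subr0.
Qed.

Lemma root_support_edge s u t : coxeter_edge u t ->
  root_support s u -> root_support s t.
Proof.
move=> ut [w0 w0u].
(* Replacing [w0] by [s w0] negates the root, so it may be taken positive. *)
have [w wpos wu] : exists2 w, (forall f, (forall v, 0 <= f v) -> 0 <= act w f s)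
    & act w (delta u) s != 0.
  have [h|h] := leqP (len WS w0) (len WS (val s * w0)%g).
    by exists w0 => // f; apply: act_ge0.
  exists (val s * w0)%g => [f|]; last first.
    rewrite actM actg /refl cox_formss //; apply: contraNneq w0u => e.
    by apply/eqP; lra.
  by apply: act_ge0 => //; rewrite genKV // ltnW.
have [wt|wt] := eqVneq (act w (delta t) s) 0; last by exists w.
exists (w * val t)%g; rewrite actM actg.
have -> : refl t (delta t) =
    fun v => 1 * delta t v + (-1) * cox_form t v.
  by apply/funext => v; rewrite /refl {2}/delta eqxx mulr1n; ring.
rewrite act_lin wt.
have tu : t != u by rewrite (coxeter_edge_neq WS) // coxeter_edge_sym.
(* If [t] is absent from the root, reflecting in [t] gives it the coefficient
   [- act w (cox_form t) s]. The function [g] is [- cox_form t] with its values at [t] and [u]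
   replaced by [0]: positivity on [g] bounds that coefficient below by the contribution of [u], with
   no infinite sum over [S]. *)
pose g v := 1 * (2 * delta t v + (-1) * cox_form t v)
            + cox_form t u * delta u v.
have g0 v : 0 <= g v.
  rewrite /g /delta; have [->|vt] := eqVneq v t.
    by rewrite cox_formss // (negPf tu) mulr1n mulr0n; lra.
  have [->|vu] := eqVneq v u; first by rewrite mulr1n mulr0n; lra.
  have := cox_form_le0 R WS (_ : t != v).
  by rewrite eq_sym vt mulr0n => /(_ isT); lra.
have := wpos g g0; rewrite !act_lin wt => gs.
have u0 : 0 < act w (delta u) s.
  by rewrite lt_def wu wpos // => v; rewrite /delta ler0n.
have tu0 : cox_form t u < 0 by rewrite cox_form_lt0 // coxeter_edge_sym.
have := mulr_gt0 u0 (_ : 0 < - cox_form t u); rewrite oppr_gt0 => /(_ tu0) ?.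
by apply: lt0r_neq0; lra.
Qed.

Lemma finite_component s :
  finite_set (root_orbit s) -> finite_set (connected_component s).
Proof.
move=> /finite_root_support; apply: sub_finite_set => t [p].
have ss : root_support s s.
  by exists 1%g; rewrite act1 /delta eqxx oner_eq0.
elim: p {2 3 4}s ss => [|v p IH] u us /=; first by move=> _ <-.
by move=> /andP[uv vp]; apply: IH vp; apply: root_support_edge us.
Qed.

Lemma finite_parabolic_component s : finite_set (root_orbit s) ->
  finite_set (parabolic (connected_component s)).
Proof.
move=> fs; have /finite_seqP[l lE] := finite_component fs.
have lP u : u \in l <-> connected_component s u by rewrite lE.
apply: (@finite_fibers _ _ _ (fun w => [seq (fun f => act w f u) | u <- l])).
  apply: (@sub_finite_set _ _
    (range (fun w => [seq (fun f => act w f u) | u <- l]))).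
    by move=> _ [w _ <-]; exists w.
  apply: finite_range_map => u ul; apply: finite_orbit_component fs.
  exact/lP.
move=> w Iw; apply: (sub_finite_set _ (finite_set1 w)) => v [Iv vw] /=.
have [I1 IM IV] := parabolic_subgroup (connected_component s).
suff : (v * w^-1)%g = 1%g by move=> e; rewrite -[v]mulg1 -(mulVg w) mulgA e mul1g.
apply: (act_faithful WS act1 actM actg) => f; apply/funext => u.
(* Inside the component [v] and [w] give the same functionals; outside it, the letters of [v w^-1]
   are orthogonal to [u] and leave the value there unchanged. *)
have [us|us] := pselect (connected_component s u).
  rewrite actM -[RHS](congr1 (fun h => h u) (act1 f)) -(mulgV w) actM.
  have /eq_in_map/(_ u) := vw; rewrite lP => /(_ us) e.
  exact: (congr1 (fun phi => phi (act w^-1%g f)) e).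
have [p ps ->] := parabolicP WS (IM _ _ Iv (IV _ Iw)).
elim: p ps => [|t p IH] ps; first by rewrite act1.
have st : connected_component s t by apply: ps; rewrite mem_head.
rewrite actM actg /refl IH => [|x xp]; last by apply: ps; rewrite inE xp orbT.
rewrite cox_form_eq0 ?mulr0 ?subr0 //; first by apply: contra_notN us => /eqP <-.
by apply: contra_notN us; apply: connected_component_edge.
Qed.
End Orbits.

(** * Irreducible components and their products *)

Section Components.
Local Open Scope group_scope.
Local Open Scope classical_set_scope.
Variables (W : groupType) (S : set W).
Hypothesis WS : coxeter_system S.
Implicit Types (s t u : S) (w : W) (C : set W) (l : seq (set W)).

Lemma connected_component_refl s : connected_component s s.
Proof. by exists [::]. Qed.

Lemma connected_component_trans s t u :
  connected_component s t -> connected_component t u -> connected_component s u.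
Proof.
by case=> p sp <- [q tq <-]; exists (p ++ q); rewrite ?last_cat // cat_path sp.
Qed.

Lemma connected_component_sym s t :
  connected_component s t -> connected_component t s.
Proof.
case=> p; elim: p s => [|v p IH] s /=; first by move=> _ ->; exists [::].
move=> /andP[sv vp] /(IH _ vp) tv; apply: connected_component_edge tv _.
by rewrite coxeter_edge_sym.
Qed.

Lemma connected_component_eq s t : connected_component s t ->
  connected_component s = connected_component t.
Proof.
move=> st; have ts := connected_component_sym st.
by apply/seteqP; split=> u; apply: connected_component_trans.
Qed.

Lemma parabolic_gen (I : set S) s : I s -> parabolic I (val s).
Proof. by move=> Is H [_ HI]; apply: HI; exists s. Qed.

Lemma component_comm s t w : ~ connected_component s t ->
  parabolic (connected_component t) w -> val s * w = w * val s.
Proof.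
move=> nst /(parabolicP WS)[p pt ->].
elim: p pt => [|u p IH] pt; first by rewrite mulg1 mul1g.
have tu : connected_component t u by apply: pt; rewrite mem_head.
rewrite /= mulgA (coxeter_comm WS) -?mulgA ?IH //.
  by move=> x xp; apply: pt; rewrite inE xp orbT.
apply: contra_notN nst => su; apply: connected_component_sym.
by apply: connected_component_edge tu _; rewrite coxeter_edge_sym.
Qed.

Definition prod_sets l : set W :=
  foldr (fun C E => [set c * e | c in C & e in E]) [set 1] l.

Lemma finite_prod_sets l :
  (forall C, C \in l -> finite_set C) -> finite_set (prod_sets l).
Proof.
elim: l => [_|C l IH fl] /=; first exact: finite_set1.
apply: finite_image2; first by apply: fl; rewrite mem_head.
by apply: IH => D Dl; apply: fl; rewrite inE Dl orbT.
Qed.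

(** A generator commutes with every component other than its own, so it moves right until it meets
    its own factor, or past all of them. *)
Lemma prod_sets_gen l s e : (forall C, C \in l -> irreducible_component S C) ->
  prod_sets l e ->
  if parabolic (connected_component s) \in l then prod_sets l (val s * e)
  else val s * e = e * val s.
Proof.
elim: l e => [|C l IH] e irrl; first by move=> /= ->; rewrite mulg1 mul1g.
case=> c Cc [e' le' <-]; rewrite inE.
have irrl' D : D \in l -> irreducible_component S D.
  by move=> Dl; apply: irrl; rewrite inE Dl orbT.
have {}IH := IH e' irrl' le'.
have [t CE] := irrl C (mem_head _ _).
have [sC|sC] := eqVneq (parabolic (connected_component s)) C.
  exists (val s * c); last by exists e'; rewrite ?mulgA.
  have [_ CM _] := parabolic_subgroup (connected_component s).
  rewrite -sC; apply: CM; last by rewrite sC.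
  by apply: parabolic_gen; apply: connected_component_refl.
have sc : val s * c = c * val s.
  apply: (@component_comm s t); last by rewrite -CE.
  by move=> /connected_component_eq e''; case/eqP: sC; rewrite CE e''.
rewrite /= mulgA sc -mulgA; case: ifP IH => _ IH.
  by exists c => //; exists (val s * e').
by rewrite IH mulgA.
Qed.

End Components.

(** * The fixed subgroup of a graph automorphism *)

Section FixedPoints.
Local Open Scope classical_set_scope.
Variables (W : groupType) (S : set W).
Hypothesis WS : coxeter_system S.
Variable tau : S -> S.
Hypothesis tauA : coxeter_graph_aut tau.
Implicit Types (s t u v : S) (w : W).
Local Notation phi := (ext_aut tau).
Local Notation H := (fixed_subgroup tau).

Lemma ext_autM : {morph phi : x y / (x * y)%g}.
Proof. by case: (ext_autP WS tauA). Qed.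

Lemma ext_autE s : phi (val s) = val (tau s).
Proof. by case: (ext_autP WS tauA). Qed.

Lemma ext_aut1 : phi 1%g = 1%g.
Proof. by apply: (@mulgI _ (phi 1%g)); rewrite -ext_autM !mulg1. Qed.

Lemma graph_aut_inj : injective tau.
Proof. by case: tauA => /bij_inj. Qed.

Lemma fixed_subgroupP : is_subgroup H.
Proof.
split=> [|x y Hx Hy|x Hx]; rewrite /fixed_subgroup /= ?ext_aut1 //.
- by rewrite ext_autM Hx Hy.
- by apply: (@mulgI _ (phi x)); rewrite -ext_autM mulgV ext_aut1 Hx mulgV.
Qed.

Lemma left_coset_fixed x y : left_coset x H = left_coset y H -> H (x^-1 * y)%g.
Proof.
have [H1 _ _] := fixed_subgroupP => xy.
have : left_coset y H y by exists 1%g; rewrite ?mulg1.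
by rewrite -xy => -[h Hh <-]; rewrite mulKg.
Qed.

Lemma left_cosetM x h : H h -> left_coset (x * h)%g H = left_coset x H.
Proof.
have [H1 HM HV] := fixed_subgroupP => Hh.
apply/seteqP; split=> _ [k Hk <-].
  by exists (h * k)%g; [apply: HM|rewrite mulgA].
by exists (h^-1 * k)%g; [apply: HM => //; apply: HV|rewrite mulgA mulgK].
Qed.

Section Action.
Local Open Scope ring_scope.
Variable R : realType.
Variable act : W -> (S -> R) -> (S -> R).
Hypothesis act1 : forall f, act 1%g f = f.
Hypothesis actM : forall w w' f, act (w * w')%g f = act w (act w' f).
Hypothesis actg : forall s f, act (val s) f = refl s f.
Implicit Types (f h : S -> R).
Local Notation cox_form := (@cox_form R W S).
Local Notation delta := (@delta R W S).
Let act_lin := act_lin WS act1 actM actg.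

(** Invariance of the form: the pairing of [s] with [w^-1 t] equals that of [w s] with [t]. *)
Lemma act_adjoint w s t : act w (cox_form s) t = act w^-1%g (cox_form t) s.
Proof.
elim/(gen_ind WS): w s t => [|u w IH] s t.
  by rewrite invg1 !act1 cox_formC.
rewrite invgM (genV WS) !actM !actg.
have -> : refl u (cox_form t) =
    fun v => 1 * cox_form t v + (- cox_form t u) * cox_form u v.
  by apply/funext => v; rewrite /refl; ring.
by rewrite act_lin -!IH /refl (cox_formC R WS t u); ring.
Qed.

Lemma act_ext_aut w f u : act (phi w) f (tau u) = act w (f \o tau) u.
Proof.
elim/(gen_ind WS): w u => [|s w IH] u; first by rewrite ext_aut1 !act1.
rewrite ext_autM ext_autE !actM !actg /refl !IH.
by congr (_ - _ * _); rewrite /cox_form graph_aut_m.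
Qed.

(* With [r = tau s], the element [n] commutes with [rs], whose fixed space in
   the dual is [f s = f r = 0]; hence [n] preserves the plane spanned by the
   simple roots [s] and [r], and it acts there by a scalar, or by a combination
   [x + y tau] when [tau] swaps them. Invariance of the form does the rest. *)
Lemma act_fixed_moved n s : tau s <> s -> H n -> H (val s * n * val s)%g ->
  [set fun f => f s; fun f => - f s; fun f => f (tau s); fun f => - f (tau s)]
    (fun f => act n f s).
Proof.
move=> /eqP; rewrite eq_sym; set r := tau s => sr Hn Hsns.
have {Hsns}comm : (n * (val r * val s) = val r * val s * n)%g.
  have e : (val r * n * val r = val s * n * val s)%g.
    by rewrite -[RHS]Hsns !ext_autM !ext_autE Hn.
  have := congr1 (fun x => val r * x * val s)%g e.
  by rewrite -!mulgA (genKV WS) (genK WS) mulg1.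
set c := cox_form s r; have cE : cox_form r s = c by rewrite cox_formC.
have c4 : 4 - c ^+ 2 != 0 by apply: cox_form_neq.
have vanish f : f s = 0 -> f r = 0 -> act n f s = 0 /\ act n f r = 0.
  move=> fs fr; have e : act (val r * val s)%g f = f.
    by rewrite actM !actg; apply/funext => u; rewrite /refl fs fr; ring.
  have := actM (val r * val s) n f; rewrite -comm actM e.
  rewrite actM !actg; move: (act n f) => h he.
  have := congr1 (fun g => g r) he; have := congr1 (fun g => g s) he.
  rewrite /refl !cox_formss // cE -/c => e1 e2.
  have hr : h r = c * h s / 2 by lra.
  have hs : (4 - c ^+ 2) * h s = 0 by rewrite hr in e1; lra.
  have {}hs : h s = 0 by apply/eqP; move/eqP: hs; rewrite mulf_eq0 (negPf c4).
  by rewrite hr hs mulr0 mul0r.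
pose x := act n (delta s) s; pose y := act n (delta r) s.
have ns f : act n f s = x * f s + y * f r.
  (* Removing the components of [f] along [delta s] and [delta r] leaves a function to which
     [vanish] applies. *)
  pose g u := 1 * f u + (-1) * (f s * delta s u + f r * delta r u).
  have [] := vanish g.
  - by rewrite /g /delta eqxx (negPf sr) mulr1n mulr0n; ring.
  - by rewrite /g /delta eqxx eq_sym (negPf sr) mulr1n mulr0n; ring.
  by rewrite !act_lin -/x -/y => + _; lra.
clearbody x y.
have nr f : act n f r = x * f r + y * f (tau r).
  by rewrite -{1}Hn /r act_ext_aut ns.
have Vn : act n^-1%g (cox_form s) = fun u => x * cox_form s u + y * cox_form r u.
  apply/funext => u; rewrite -act_adjoint ns.
  by rewrite (cox_formC R WS u s) (cox_formC R WS u r).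
have nVn : cox_form s = act n (fun u => x * cox_form s u + y * cox_form r u).
  by rewrite -Vn -actM mulgV act1.
(* [eqs] says that the root [n^-1 s = x s + y r] still has norm [2]; [eqr] says that its pairing
   with [n^-1 r] is still [c]. *)
have eqs := congr1 (fun h => h s) nVn; have eqr := congr1 (fun h => h r) nVn.
rewrite /= ns !cox_formss // cE -/c in eqs.
have [y0|y0] := eqVneq y 0.
  have : (x - 1) * (x + 1) = 0.
    have -> : (x - 1) * (x + 1) =
      (x * (x * 2 + y * c) + y * (x * c + y * 2)) / 2 - 1 by rewrite y0; field.
    by rewrite -eqs divff ?subrr // pnatr_eq0.
  move=> /eqP; rewrite mulf_eq0 subr_eq0 addr_eq0 => /orP[] /eqP x1.
    by do 3 left; apply/funext => f; rewrite ns y0 x1; ring.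
  by do 2 left; right; apply/funext => f; rewrite ns y0 x1; ring.
(* Otherwise [delta (tau r)] vanishes at [s] and [r], while its image under [n] takes the value [y]
   at [r]. *)
have rs : tau r = s.
  apply/eqP; apply: contraNT y0 => rs.
  have rr : tau r != r by apply: contraNneq sr => /graph_aut_inj ->.
  have [] := vanish (delta (tau r)).
  - by rewrite /delta eq_sym (negPf rs).
  - by rewrite /delta eq_sym (negPf rr).
  by rewrite nr /delta eqxx eq_sym (negPf rr) mulr0 add0r mulr1 => _ ->.
rewrite /= nr rs !cox_formss // cE -/c in eqr.
have xy : (4 - c ^+ 2) * (x * y) = 0.
  have -> : (4 - c ^+ 2) * (x * y) =
    (x * (x * c + y * 2) + y * (x * 2 + y * c)) -
    c * ((x * (x * 2 + y * c) + y * (x * c + y * 2)) / 2) by field.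
  by rewrite -eqs -eqr; field.
have x0 : x = 0.
  by apply/eqP; move/eqP: xy; rewrite !mulf_eq0 (negPf c4) (negPf y0) orbF.
have : (y - 1) * (y + 1) = 0.
  have -> : (y - 1) * (y + 1) =
    (x * (x * 2 + y * c) + y * (x * c + y * 2)) / 2 - 1 by rewrite x0; field.
  by rewrite -eqs divff ?subrr // pnatr_eq0.
move=> /eqP; rewrite mulf_eq0 subr_eq0 addr_eq0 => /orP[] /eqP y1.
  by left; right; apply/funext => f; rewrite ns x0 y1; ring.
by right; apply/funext => f; rewrite ns x0 y1; ring.
Qed.

(** If [v] and [w] share both cosets, then [n = v w^-1] and [s n s] are fixed, so [act_fixed_moved]
    leaves at most four roots for each of the finitely many pairs of cosets. *)
Lemma finite_orbit_moved s : finite_index H -> tau s <> s ->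
  finite_set (root_orbit act s).
Proof.
move=> fH ms; apply: (@finite_image_fibers _ _ _ _ _
  (fun w => (left_coset w^-1%g H, left_coset (w^-1 * val s)%g H))).
  apply: sub_finite_set (finite_setX fH fH) => _ [w _ <-].
  by split; [exists w^-1%g|exists (w^-1 * val s)%g].
move=> w _; apply: (@sub_finite_set _ _
  [set fun f => act w f s; fun f => - act w f s;
       fun f => act w f (tau s); fun f => - act w f (tau s)]); last first.
  exact: finite_set4.
move=> _ [v [_ [/left_coset_fixed vw /left_coset_fixed vsw]] <-].
rewrite invgK in vw; rewrite invgM invgK (genV WS) !mulgA in vsw.
have := act_fixed_moved ms vw; rewrite !mulgA => /(_ vsw).
have -> : (fun f => act v f s) = (fun f => act (v * w^-1)%g (act w f) s).
  by apply/funext => f; rewrite -actM -mulgA mulVg mulg1.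
by move=> [[[]|]|] e; [do 3 left|do 2 left; right|left; right|right];
  apply/funext => f; rewrite (congr1 (fun phi => phi (act w f)) e).
Qed.

Lemma finite_moved : finite_index H -> finite_set [set s | tau s <> s].
Proof.
move=> fH; apply: (@finite_fibers _ _ _ (fun s => left_coset (val s) H)).
  by apply: sub_finite_set fH => _ [s _ <-]; exists (val s).
move=> s ms; apply: sub_finite_set (finite_set2 s (tau s)) => t [mt].
move=> /left_coset_fixed; rewrite (genV WS) /fixed_subgroup /=.
rewrite ext_autM !ext_autE => ts.
have [->|nts] := eqVneq t s; first by left.
have [->|ntr] := eqVneq t (tau s); first by right.
(* None of [tau t], [tau s], [s] equals [t], so [tau t * tau s] fixes [delta t], whereas [t * s]
   sends its value at [t] from [1] to [-1]. *)
have := congr1 (fun w => act w (delta t) t) ts.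
rewrite !actM !actg /refl cox_formss // /delta.
rewrite eqxx [tau s == t]eq_sym (negPf ntr) [s == t]eq_sym (negPf nts).
rewrite (negPf (introN eqP mt)) !mulr0n !mulr1n.
rewrite !(mul0r, subr0) mul1r -{1}[1]addr0 => /addrI/eqP.
by rewrite eq_sym oppr_eq0 pnatr_eq0.
Qed.

End Action.
End FixedPoints.

(** * The finite index criterion *)

Local Open Scope group_scope.
Local Open Scope classical_set_scope.

Theorem theorem5p1 (W : groupType) (S : set W) (tau : S -> S) :
  coxeter_system S ->
  coxeter_graph_aut tau ->
  finite_index (fixed_subgroup tau) <->
  exists F : set (set W),
    [/\ finite_set F,
        forall C, F C -> irreducible_component S C /\ finite_set C &
        forall C, irreducible_component S C -> ~ F C ->
          forall w, C w -> ext_aut tau w = w].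
Proof.
move=> WS tauA; have [H1 HM _] := fixed_subgroupP WS tauA; split=> [fH|[F]].
  have [act [act1 actM actg]] := geometric_action Rdefinitions.R WS.
  (* A component that is not fixed pointwise contains a moved generator, since a product of fixed
     generators is fixed. *)
  have movedP s : (exists2 w, parabolic (connected_component s) w &
      ext_aut tau w <> w) -> exists2 u, connected_component s u & tau u <> u.
    case=> w /(parabolicP WS)[p ps ->] pm; apply: contrapT => nm; apply: pm.
    elim: p ps => [|u p IH] ps; first exact: H1.
    apply: HM; last by apply: IH => x xp; apply: ps; rewrite inE xp orbT.
    rewrite /fixed_subgroup /= (ext_autE WS tauA); congr val; apply: contrapT.
    by move=> um; apply: nm; exists u => //; apply: ps; rewrite mem_head.
  exists [set C | irreducible_component S C /\
                  exists2 w, C w & ext_aut tau w <> w]; split.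
  - apply: (@sub_finite_set _ _
      ((fun s => parabolic (connected_component s)) @` [set s | tau s <> s])).
      move=> _ [[s ->] /movedP[u su um]].
      by exists u; rewrite // (connected_component_eq WS su).
    by apply: finite_image; apply: (finite_moved WS tauA actM actg fH).
  - move=> C [irrC Cm]; split=> //; move: irrC Cm => [s ->] /movedP[u su um].
    rewrite (connected_component_eq WS su).
    apply: (finite_parabolic_component WS act1 actM actg).
    exact: (finite_orbit_moved WS tauA act1 actM actg).
  - move=> C irrC nF w Cw; apply: contrapT => wm; apply: nF.
    by split=> //; exists w.
case=> /finite_seqP[l ->] lC fixC.
have lirr C : C \in l -> irreducible_component S C by move=> /lC[].
have lfin C : C \in l -> finite_set C by move=> /lC[].
apply: (@sub_finite_set _ _
  ((fun e => left_coset e (fixed_subgroup tau)) @` prod_sets l)); last first.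
  exact/finite_image/finite_prod_sets.
move=> _ [w _ <-].
have [e le [h Hh ->]] : exists2 e, prod_sets l e &
    exists2 h, fixed_subgroup tau h & w = e * h.
  (* A new letter is absorbed by [e] if its component is exceptional; otherwise it commutes with
     [e], is fixed by [tau], and joins [h]. *)
  elim/(gen_ind WS): w => [|s w [e le [h Hh ->]]].
    exists 1; last by exists 1; rewrite ?mulg1.
    elim: l {lC fixC lfin} lirr => [//|C l IH] lirr; exists 1.
      have [s ->] := lirr C (mem_head _ _).
      by have [] := parabolic_subgroup (connected_component s).
    exists 1; last by rewrite mulg1.
    by apply: IH => D Dl; apply: lirr; rewrite inE Dl orbT.
  have := prod_sets_gen WS s lirr le; case: ifP => sl se.
    by exists (val s * e) => //; exists h; rewrite ?mulgA.
  exists e => //; exists (val s * h); last by rewrite !mulgA se.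
  apply: HM => //; apply: (fixC (parabolic (connected_component s))).
  - by exists s.
  - by rewrite /= sl.
  - by apply: parabolic_gen; apply: connected_component_refl.
by exists e => //; rewrite (left_cosetM WS tauA).
Qed.
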